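(* Let $\alpha \doteq 2.324717957$ be the real zero of the polynomial $X^3 - 3X^2 + 2X - 1$, let $\tau = (1+\sqrt{5})/2$, and let $b$ be a real number. (a) If $b \geq \alpha$, then $\lim_{n \to \infty} M_b(n) = \prod_{t \geq 1} (1 - b^{-t})^{-1}$. (b) If $\tau \leq b \leq \alpha$, then $\lim_{n \to \infty} M_b(n) = \frac{b^2 - b + 1}{b(b-1)^2} \prod_{t \geq 1} (1 - b^{-t})^{-1}$.
   Context: For a positive integer $n$ and a real number $b > 1$, $M_b(n)$ denotes the maximum of the absolute values of the entries of the inverse of the (invertible) $n \times n$ Vandermonde matrix $V(b^0, b^1, \ldots, b^{n-1}) = [b^{ij}]_{0 \leq i,j < n}$. Products over $t \geq 1$ run over all positive integers $t$. *)

(* Defs.v *)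
From mathcomp Require Import all_boot all_order all_algebra.
From mathcomp Require Import all_classical all_reals all_analysis.
From mathcomp Require Import ring lra.

Set Implicit Arguments.
Unset Strict Implicit.
Unset Printing Implicit Defensive.

Import Order.TTheory GRing.Theory Num.Theory.
Import numFieldNormedType.Exports.

Local Open Scope classical_set_scope.
Local Open Scope ring_scope.

(* [Vandermonde n a] has entries [a 0 j ^+ i], so this is [b^(i j)] with
   indices starting at 0. *)
Definition vandermonde_pow (R : realType) (b : R) (n : nat) : 'M[R]_n :=
  Vandermonde n (\row_(j < n) b ^+ j).

(* [mx_norm] is the largest absolute value of an entry. For 1 < b the matrix
   is invertible, so [invmx] is its true inverse; the value at n = 0 is 0. *)
Definition max_inv_entry (R : realType) (b : R) (n : nat) : R :=
  mx_norm (invmx (vandermonde_pow b n)).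

(* The product over t >= 1 of f t, as the limit of its partial products. *)
Definition inf_prod (R : realType) (f : nat -> R) : R :=
  limn (fun N : nat => \prod_(1 <= t < N.+1) f t).

Definition alpha_poly (R : realType) : {poly R} :=
  'X^3 - 3%:R *: 'X^2 + 2%:R *: 'X - 1.

Definition golden_ratio (R : realType) : R := (1 + Num.sqrt 5%:R) / 2%:R.

Lemma vandermonde_pow_unit (R : realType) (b : R) (n : nat) :
  1 < b -> vandermonde_pow b n \in unitmx.
Proof.
move=> b1; rewrite unitmxE det_Vandermonde unitfE.
apply/prodf_neq0 => i _; apply/prodf_neq0 => j ij.
rewrite !mxE subr_eq0; apply/eqP => e.
have : b ^+ i < b ^+ j by rewrite ltr_eXn2l.
by rewrite e ltxx.
Qed.

(* "The" real zero of the cubic exists, is unique, and is 2.324717957... *)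
Lemma alpha_poly_root (R : realType) :
  exists2 x : R,
    2 + 324 / 10 ^+ 3 + 717 / 10 ^+ 6 + 957 / 10 ^+ 9 < x
      < 2 + 324 / 10 ^+ 3 + 717 / 10 ^+ 6 + 958 / 10 ^+ 9
    & forall y : R, root (alpha_poly R) y <-> y = x.
Proof.
have E (y : R) : (alpha_poly R).[y] = y ^+ 3 - 3 * y ^+ 2 + 2 * y - 1.
  by rewrite /alpha_poly !hornerE.
pose u : R := 2 + 324 / 10 ^+ 3 + 717 / 10 ^+ 6 + 957 / 10 ^+ 9.
pose v : R := 2 + 324 / 10 ^+ 3 + 717 / 10 ^+ 6 + 958 / 10 ^+ 9.
have uv : u <= v by rewrite /u /v; lra.
have u0 : (alpha_poly R).[u] < 0 by rewrite E /u; lra.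
have v0 : 0 < (alpha_poly R).[v] by rewrite E /v; lra.
have [x /andP[ux xv] rx] : exists2 x, u <= x <= v & root (alpha_poly R) x.
  by apply: poly_ivt => //; rewrite !ltW.
have x0 := rootP rx.
exists x.
  rewrite -/u -/v !lt_neqAle ux xv !andbT; apply/andP; split; apply/eqP => e.
    by move: u0; rewrite e x0 ltxx.
  by move: v0; rewrite -e x0 ltxx.
move=> y; split=> [/rootP y0|-> //].
apply/eqP; rewrite -subr_eq0; apply/eqP.
have x2 : 2 < x by apply: lt_le_trans ux; rewrite /u; lra.
have : (y - x) * (y ^+ 2 + x * y + x ^+ 2 - 3 * (y + x) + 2) = 0.
  have -> : (y - x) * (y ^+ 2 + x * y + x ^+ 2 - 3 * (y + x) + 2) =
    (alpha_poly R).[y] - (alpha_poly R).[x] by rewrite !E; ring.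
  by rewrite y0 x0 subr0.
move=> /eqP; rewrite mulf_eq0 => /orP[/eqP//|/eqP h].
have x23 : 23 / 10 < x by apply: lt_le_trans ux; rewrite /u; lra.
have := sqr_ge0 (2 * y + x - 3).
by nra.
Qed.

(* Main.v *)
(* With q = 1/b, row j of the inverse lists the coefficients of the Lagrange
   polynomial prod_(m <> j) (1 - q^m X) / (1 - b^j q^m), so the (j,k) entry has
   absolute value
     e_k(q^m : m <> j) / (prod_(t <= j) (b^t - 1) * prod_(t < n - j) (1 - q^t)).
   The (0,0) and (1,1) entries converge to P = prod_t (1 - q^t)^-1 and to
   (b^2 - b + 1) / (b (b - 1)^2) * P. When b is at least the golden ratio,
   e_k <= (1 - q)^-1, which makes the rows j >= 2 too small to matter; the
   columns k >= 2 follow by symmetry of the matrix. The cubic with root alpha is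
   b (b - 1)^2 - (b^2 - b + 1), which compares the two surviving limits. *)
Require Import Defs.
From mathcomp Require Import all_boot all_order all_algebra.
From mathcomp Require Import all_classical all_reals all_analysis.
From mathcomp Require Import ring lra.

Import Order.TTheory GRing.Theory Num.Theory.
Import numFieldNormedType.Exports.

Local Open Scope classical_set_scope.
Local Open Scope ring_scope.

(** * Coefficients of products of linear factors *)

Lemma coef_mul_1addZX (R : nzRingType) (a : R) (p : {poly R}) (k : nat) :
  ((1 + a *: 'X) * p)`_k = p`_k + (if k == 0%N then 0 else a * p`_k.-1).
Proof. by rewrite mulrDl mul1r -scalerAl coefD coefZ coefXM; case: k => [|k] //=; rewrite mulr0. Qed.

Lemma coef_prod_1addZX_ge0 (R : numDomainType) (I : Type) (s : seq I)
    (a : I -> R) (k : nat) :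
  (forall i, 0 <= a i) -> 0 <= (\prod_(i <- s) (1 + a i *: 'X))`_k.
Proof.
move=> a0; elim: s k => [|i s IH] k; first by rewrite big_nil coef1 ler0n.
rewrite big_cons coef_mul_1addZX addr_ge0 //.
by case: ifP => // _; rewrite mulr_ge0.
Qed.

(** Alternating signs only cause cancellation, and restoring an omitted factor only adds nonnegative
    terms. This passes from the product without index [j] to the full product, where a recursion is
    available. *)
Lemma norm_coef_prod_1subZX_le (R : numDomainType) (I : Type) (s : seq I)
    (P : pred I) (a : I -> R) (k : nat) :
  (forall i, 0 <= a i) ->
  `|(\prod_(i <- s | P i) (1 - a i *: 'X))`_k|
    <= (\prod_(i <- s) (1 + a i *: 'X))`_k.
Proof.
move=> a0; elim: s k => [|i s IH] k.
  by rewrite !big_nil coef1 ger0_norm ?ler0n.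
rewrite !big_cons coef_mul_1addZX; case: (P i); last first.
  rewrite (le_trans (IH k)) // lerDl; case: ifP => // _.
  by rewrite mulr_ge0 ?coef_prod_1addZX_ge0.
rewrite -scaleNr coef_mul_1addZX (le_trans (ler_normD _ _)) // lerD //.
case: ifP => _; first by rewrite normr0.
by rewrite normrM normrN (ger0_norm (a0 i)) ler_wpM2l.
Qed.

Lemma coef0_prod_1subZX (R : comNzRingType) (I : Type) (s : seq I)
    (P : pred I) (a : I -> R) :
  (\prod_(i <- s | P i) (1 - a i *: 'X))`_0 = 1.
Proof.
elim/big_rec: _ => [|i p _ IH]; first by rewrite coef1.
by rewrite -scaleNr coef_mul_1addZX IH addr0.
Qed.

Lemma coef1_prod_1subZX (R : comNzRingType) (I : Type) (s : seq I)
    (P : pred I) (a : I -> R) :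
  (\prod_(i <- s | P i) (1 - a i *: 'X))`_1 = - \sum_(i <- s | P i) a i.
Proof.
elim: s => [|i s IH]; first by rewrite !big_nil coef1 oppr0.
rewrite !big_cons; case: (P i) => //.
by rewrite -scaleNr coef_mul_1addZX IH coef0_prod_1subZX mulr1 opprD addrC.
Qed.

(* The golden ratio enters through [q + q ^+ 2 <= 1], which is what the
   recursion [e_k(1, .., q^n) = q^k e_k(1, .., q^(n-1)) + q^(k-1) e_(k-1)]
   needs to preserve the bound. *)
Lemma coef_prod_1addXnX_le (R : realFieldType) (q : R) (n k : nat) :
  0 < q -> q + q ^+ 2 <= 1 ->
  (\prod_(i < n) (1 + q ^+ i *: 'X))`_k <= (1 - q)^-1.
Proof.
move=> q0 qg; have q1 : 0 < 1 - q by have := exprn_gt0 2 q0; lra.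
have G1 : 1 <= (1 - q)^-1 by rewrite invf_ge1 //; lra.
elim: n k => [|n IH] k.
  rewrite big_ord0 coef1; case: (k == 0%N) => //=; lra.
(* Replacing ['X] by [q *: 'X] multiplies the [j]-th coefficient by [q ^+ j]. *)
have scaled j : (\prod_(i < n) (1 + q ^+ i.+1 *: 'X))`_j
    = q ^+ j * (\prod_(i < n) (1 + q ^+ i *: 'X))`_j.
  elim: n {IH} j => [|n IH] j.
    by rewrite !big_ord0 coef1; case: j => [|j]; rewrite ?mulr1 ?mulr0.
  rewrite !big_ord_recr /= ![_ * (1 + _)]mulrC !coef_mul_1addZX !IH.
  case: j => [|j] /=; first by rewrite !addr0.
  by rewrite !exprS; ring.
rewrite big_ord_recl coef_mul_1addZX expr0 mul1r.
under eq_bigr do rewrite lift0.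
rewrite !scaled; case: k => [|[|k]] /=.
- rewrite mul1r addr0; exact: IH.
(* Degree 1 dictates the bound: $(1-q)^{-1}$ is the fixed point of $x \mapsto qx + 1$. *)
- have e0 : (\prod_(i < n) (1 + q ^+ i *: 'X))`_0 = 1.
    under eq_bigr do rewrite -[_ *: 'X]opprK -scaleNr.
    exact: coef0_prod_1subZX.
  rewrite expr1 expr0 e0 !mul1r.
  have : q * (\prod_(i < n) (1 + q ^+ i *: 'X))`_1 <= q * (1 - q)^-1.
    by rewrite ler_pM2l // IH.
  have : (1 - q) * (1 - q)^-1 = 1 by rewrite mulfV // gt_eqF.
  by lra.
- set G := (1 - q)^-1 in IH G1 *.
  have qk j : 0 < q ^+ j by rewrite exprn_gt0.
  have le1 j : q ^+ j <= 1 by rewrite exprn_ile1 //; lra.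
  have le j : q ^+ j.+1 * (\prod_(i < n) (1 + q ^+ i *: 'X))`_j.+1
      <= q ^+ j.+1 * G by rewrite ler_pM2l.
  have sum_le : q ^+ k.+2 + q ^+ k.+1 <= 1.
    have -> : q ^+ k.+2 + q ^+ k.+1 = q ^+ k * (q + q ^+ 2).
      by rewrite !exprS; ring.
    by rewrite mulr_ile1 // ltW // addr_gt0 // exprn_gt0.
  rewrite (le_trans (lerD (le _) (le _))) // -mulrDl ler_piMl //; lra.
Qed.

(** * Entries of the inverse matrix *)

Lemma invmx_vandermonde_pow (R : realType) (b : R) (n : nat) (j k : 'I_n) :
  1 < b ->
  invmx (vandermonde_pow b n) j k =
    (\prod_(m < n | m != j) ((1 - b ^+ j / b ^+ m)^-1 *:
       (1 - b ^- m *: 'X)) : {poly R})`_k.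
Proof.
move=> b1; pose L (j : 'I_n) : {poly R} :=
  \prod_(m < n | m != j) ((1 - b ^+ j / b ^+ m)^-1 *: (1 - b ^- m *: 'X)).
have bn0 m : b ^+ m != 0 by rewrite expf_neq0 // gt_eqF // (lt_trans ltr01).
have szL i : (size (L i) <= n)%N.
  have szf (m : 'I_n) :
      (size ((1 - b ^+ i / b ^+ m)^-1 *: (1 - b ^- m *: 'X))%R <= 2)%N.
    rewrite (leq_trans (size_scale_leq _ _)) //.
    rewrite (leq_trans (size_polyD _ _)) // size_poly1 size_polyN geq_max /=.
    by rewrite (leq_trans (size_scale_leq _ _)) // size_polyX.
  apply: leq_trans (size_poly_prod_leq _ _) _.
  have cE : #|[pred m : 'I_n | m != i]| = n.-1.
    by rewrite cardC1 card_ord.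
  (* The product of $n-1$ factors of size at most 2 has size at most $2(n-1) + 1 - (n-1) = n$. *)
  have : (\sum_(m < n | m != i)
      size ((1 - b ^+ i / b ^+ m)^-1 *: (1 - b ^- m *: 'X))%R <= n.-1 * 2)%N.
    apply: (@leq_trans (\sum_(m < n | m != i) 2)); first exact: leq_sum.
    by rewrite sum_nat_const cE.
  rewrite cE leq_subLR => szS.
  have n0 : (0 < n)%N := leq_ltn_trans (leq0n i) (ltn_ord i).
  suff -> : (n.-1 + n = (n.-1 * 2).+1)%N by rewrite ltnS.
  by rewrite -{2}(prednK n0) addnS addnn muln2.
(* Entry $(i,l)$ of this product is the value of [L i] at $b^l$. For $i = l$ every factor is 1, the
   powers of $b$ being distinct; otherwise the factor $m = l$ vanishes. *)
have eqL : (\matrix_(i, l) (L i)`_l) *m vandermonde_pow b n = 1%:M.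
  apply/matrixP => i l; rewrite !mxE.
  under eq_bigr do rewrite !mxE.
  rewrite -(horner_coef_wide _ (szL i)) horner_prod.
  have [<-|il] := eqVneq i l.
    apply: big1 => m mi; rewrite !hornerE [b ^- m * _]mulrC mulVf //.
    rewrite subr_eq0 eq_sym; apply: contra mi => /eqP/divr1_eq e.
    by apply/eqP/val_inj/(ieexprIn (lt_trans ltr01 b1)); rewrite ?gt_eqF.
  by rewrite (bigD1 l) 1?eq_sym //= !hornerE mulVf // subrr mulr0 mul0r.
rewrite -[in LHS](mul1mx (invmx _)) -eqL -mulmxA mulmxV ?vandermonde_pow_unit //.
by rewrite mulmx1 mxE.
Qed.

(** Chosen so that [limn (euler_prod b)] is convertible to the [inf_prod] of the theorem. *)
Definition euler_prod {R : realType} (b : R) (N : nat) : R :=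
  \prod_(1 <= t < N.+1) (1 - b ^- t)^-1.

Lemma norm_invmx_vandermonde_pow (R : realType) (b : R) (n : nat)
    (j k : 'I_n) :
  1 < b ->
  `|invmx (vandermonde_pow b n) j k| =
    `|(\prod_(m < n | m != j) (1 - b ^- m *: 'X) : {poly R})`_k| *
    (\prod_(1 <= t < j.+1) (b ^+ t - 1)^-1 * euler_prod b (n - j.+1)).
Proof.
move=> b1; rewrite invmx_vandermonde_pow // scaler_prod coefZ normrM mulrC.
congr (_ * _); rewrite normr_prod.
have bp m : 0 < b ^+ m by rewrite exprn_gt0 // (lt_trans ltr01).
have bU m : b ^+ m \is a GRing.unit by rewrite unitfE gt_eqF.
have bE1 m : 1 <= b ^+ m by rewrite exprn_ege1 // ltW.
pose F m := `|(1 - b ^+ j / b ^+ m)^-1|.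
transitivity (\prod_(0 <= m < n | m != j) F m); first by rewrite big_mkord.
(* Split at $m = j$. Below, $t = j - m$ gives $(b^t - 1)^{-1}$, after reversing the range; above, $t
   = m - j$ runs up to $n - j - 1$ and gives the Euler factors. *)
rewrite big_mkcond (big_cat_nat (n := j)) ?leq0n ?(ltnW (ltn_ord j)) //=.
rewrite (big_ltn (ltn_ord j)) eqxx mul1r; congr (_ * _).
  rewrite [RHS]big_nat_rev /= big_add1 /=.
  apply: eq_big_nat => m /= mj; rewrite neq_ltn mj /= /F.
  rewrite add1n !subSS -(expfB b mj) normfV distrC ger0_norm //.
  by rewrite subr_ge0.
rewrite -add1n big_addn /euler_prod subnSK ?ltn_ord //.
apply: eq_big_nat => t /andP[t1 _].
rewrite -[X in _ != X]add0n eqn_add2r -lt0n t1 /F exprD.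
rewrite invrM // mulrA mulrV // mul1r ger0_norm //.
by rewrite invr_ge0 subr_ge0 invf_le1.
Qed.

(** * Monotonicity and convergence of the Euler product *)

Lemma euler_prod_ge0 (R : realType) (b : R) (N : nat) :
  1 < b -> 0 <= euler_prod b N.
Proof.
move=> b1; apply: prodr_ge0 => t _.
by rewrite invr_ge0 subr_ge0 invf_le1 ?exprn_ege1 ?exprn_gt0 //; lra.
Qed.

Lemma euler_prod_nondecreasing (R : realType) (b : R) :
  1 < b -> nondecreasing_seq (euler_prod b).
Proof.
move=> b1; apply/nondecreasing_seqP => N.
rewrite /euler_prod [leRHS]big_nat_recr //=.
rewrite ler_peMr ?euler_prod_ge0 // invf_ge1.
  by rewrite gerBl invr_ge0 exprn_ge0 //; lra.
by rewrite subr_gt0 invf_lt1 ?exprn_egt1 ?exprn_gt0 //; lra.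
Qed.

(* [(1 - x)^-1 = 1 + x / (1 - x) <= exp (x / (1 - q))] for [x <= q] bounds the
   partial products by the exponential of a geometric sum. *)
Lemma euler_prod_is_cvgn (R : realType) (b : R) :
  1 < b -> cvgn (euler_prod b).
Proof.
move=> b1; apply: nondecreasing_is_cvgn; first exact: euler_prod_nondecreasing.
have b0 : 0 < b by lra.
set q := b^-1; have q0 : 0 < q by rewrite invr_gt0.
have q1 : 0 < 1 - q by rewrite subr_gt0 invf_lt1.
exists (expR ((1 - q)^-1 * (1 - q)^-1)) => _ [N _ <-].
have geo : \sum_(1 <= t < N.+1) q ^+ t <= (1 - q)^-1.
  have : \sum_(1 <= t < N.+1) q ^+ t <= \sum_(t < N.+1) q ^+ t.
    by rewrite -(big_mkord xpredT (fun t => q ^+ t)) [leRHS]big_ltn // lerDr.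
  move=> /le_trans; apply; rewrite -[(1 - q)^-1]mul1r ler_pdivlMr //.
  have := subrX1 q N.+1; have := exprn_gt0 N.+1 q0; lra.
apply: (@le_trans _ _ (expR (\sum_(1 <= t < N.+1) q ^+ t / (1 - q)))); last first.
  by rewrite ler_expR -mulr_suml ler_pM2r // invr_gt0.
rewrite expR_sum /euler_prod big_nat [leRHS]big_nat.
apply: ler_prod => t /andP[t1 _]; rewrite -exprVn -/q.
have qtq : q ^+ t <= q by rewrite -[leRHS]expr1 ler_wiXn2l //; lra.
have qt0 : 0 < q ^+ t by rewrite exprn_gt0.
have d0 : 0 < 1 - q ^+ t by lra.
rewrite invr_ge0 (ltW d0) /= (le_trans _ (expR_ge1Dx _)) //.
have -> : (1 - q ^+ t)^-1 = 1 + q ^+ t / (1 - q ^+ t).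
  by field; rewrite gt_eqF.
by rewrite lerD2l ler_pM2l // lef_pV2 ?posrE //; lra.
Qed.

Lemma euler_prod_le_lim (R : realType) (b : R) (N : nat) :
  1 < b -> euler_prod b N <= limn (euler_prod b).
Proof.
move=> b1; apply: nondecreasing_cvgn_le; last exact: euler_prod_is_cvgn.
exact: euler_prod_nondecreasing.
Qed.

(** * Bounds on individual entries *)

Lemma mx_norm_le (R : realDomainType) (m n : nat) (A : 'M[R]_(m, n)) (x : R) :
  0 <= x -> (forall i j, `|A i j| <= x) -> mx_norm A <= x.
Proof. by move=> x0 Ax; rewrite mx_normrE; apply: bigmax_le => // i _. Qed.

Lemma entry_le_mx_norm (R : realDomainType) (m n : nat) (A : 'M[R]_(m, n)) i j :
  `|A i j| <= mx_norm A.
Proof.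
by rewrite mx_normrE; apply: (le_bigmax (0 : R) (fun ij => `|A ij.1 ij.2|) (i, j)).
Qed.

Lemma invmx_vandermonde_pow_sym (R : realType) (b : R) (n : nat) (j k : 'I_n) :
  invmx (vandermonde_pow b n) j k = invmx (vandermonde_pow b n) k j.
Proof.
have VT : (vandermonde_pow b n)^T = vandermonde_pow b n.
  by apply/matrixP => i l; rewrite !mxE -!exprM mulnC.
by rewrite -[in RHS]VT -trmx_inv mxE.
Qed.

(** With $q = 1/b$ this is $((1-q)^{-1} - q)/(b-1)$: the sum of all powers of $q$ except $q^1$,
    divided by $b - 1$. *)
Definition entry11_ratio {R : realType} (b : R) : R :=
  (b ^+ 2 - b + 1) / (b * (b - 1) ^+ 2).

Lemma norm_invmx_00 (R : realType) (b : R) (n : nat) :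
  1 < b -> `|invmx (vandermonde_pow b n.+2) 0 0| = euler_prod b n.+1.
Proof.
move=> b1; rewrite norm_invmx_vandermonde_pow // coef0_prod_1subZX normr1.
by rewrite big_geq // !mul1r subn1.
Qed.

Lemma norm_invmx_10 (R : realType) (b : R) (n : nat) :
  1 < b ->
  `|invmx (vandermonde_pow b n.+2) 1 0| = (b - 1)^-1 * euler_prod b n.
Proof.
move=> b1; rewrite norm_invmx_vandermonde_pow // coef0_prod_1subZX normr1.
by rewrite big_nat1 expr1 mul1r subn2.
Qed.

(** The subtracted term is the missing tail of the geometric series, cut off at $n+2$ terms. *)
Lemma norm_invmx_11 (R : realType) (b : R) (n : nat) :
  1 < b ->
  `|invmx (vandermonde_pow b n.+2) 1 1| =
    (entry11_ratio b - b ^- n.+2 * b / (b - 1) ^+ 2) * euler_prod b n.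
Proof.
move=> b1; rewrite norm_invmx_vandermonde_pow // coef1_prod_1subZX normrN.
rewrite big_nat1 expr1 subn2 mulrA; congr (_ * _).
have b0 : 0 < b by lra.
rewrite ger0_norm ?sumr_ge0 // => [|i _]; last by rewrite invr_ge0 exprn_ge0 ?ltW.
have : \sum_(m < n.+2 | m != 1) b ^- m
    = \sum_(m < n.+2) b^-1 ^+ m - b^-1.
  rewrite [in RHS](bigD1 (1 : 'I_n.+2)) //= expr1 addrC addrK.
  by apply: eq_bigr => i _; rewrite exprVn.
move=> ->; have := subrX1 b^-1 n.+2; rewrite exprVn /entry11_ratio.
move: (\sum_(m < n.+2) _) (b ^- n.+2) => S x e.
have -> : S = (1 - x) * b / (b - 1).
  have -> : x = (b^-1 - 1) * S + 1 by rewrite -e; ring.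
  by field; rewrite !gt_eqF //; lra.
by field; rewrite !gt_eqF //; lra.
Qed.

(** Only $t = 1, 2$ are kept: for $t \geq 3$, $b^t - 1 \geq b^2 - 1 \geq b > 1$. *)
Lemma prod_pow_sub1_inv_le (R : realFieldType) (b : R) (j : nat) :
  b + 1 <= b ^+ 2 -> 1 < b -> (2 <= j)%N ->
  \prod_(1 <= t < j.+1) (b ^+ t - 1)^-1 <= ((b - 1) * (b ^+ 2 - 1))^-1.
Proof.
move=> bg b1; case: j => [|[|j]] // _.
rewrite big_ltn // big_ltn // expr1 mulrA -invfM.
have p0 : 0 < (b - 1) * (b ^+ 2 - 1) by rewrite mulr_gt0 //; lra.
rewrite ler_piMr ?invr_ge0 ?(ltW p0) //.
rewrite big_nat; apply: prodr_ile1 => t /andP[t3 _].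
have : b ^+ 2 <= b ^+ t by rewrite ler_weXn2l ?(ltW b1) ?(ltnW t3).
by move=> bt; rewrite invr_ge0 invf_le1 //; lra.
Qed.

Lemma norm_invmx_ge2_le (R : realType) (b : R) (n : nat) (j k : 'I_n) :
  1 < b -> b + 1 <= b ^+ 2 -> (2 <= j)%N ->
  `|invmx (vandermonde_pow b n) j k|
    <= entry11_ratio b * limn (euler_prod b).
Proof.
move=> b1 bg j2; rewrite norm_invmx_vandermonde_pow // mulrA.
have b0 : 0 < b by lra.
have coef_le : `|(\prod_(m < n | m != j) (1 - b ^- m *: 'X) : {poly R})`_k|
    <= (1 - b^-1)^-1.
  have q0 (m : 'I_n) : 0 <= b ^- m by rewrite invr_ge0 exprn_ge0 // ltW.
  apply: le_trans (norm_coef_prod_1subZX_le _ _ _ _ _ _ q0) _.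
  under eq_bigr do rewrite -exprVn.
  apply: coef_prod_1addXnX_le; first by rewrite invr_gt0.
  have -> : b^-1 + b^-1 ^+ 2 = (b + 1) / b ^+ 2 by field; rewrite gt_eqF.
  by rewrite ler_pdivrMr ?mul1r // exprn_gt0.
apply: ler_pM; last 1 first.
- exact: euler_prod_le_lim.
- rewrite mulr_ge0 //; apply: prodr_ge0 => t _.
  by rewrite invr_ge0 subr_ge0 exprn_ege1 // ltW.
- exact: euler_prod_ge0.
apply: le_trans (ler_pM (normr_ge0 _) _ coef_le (prod_pow_sub1_inv_le _ _ _ bg b1 j2)) _.
  by apply: prodr_ge0 => t _; rewrite invr_ge0 subr_ge0 exprn_ege1 // ltW.
(* Once $1/(b(b-1)^2)$ is factored out, $b^2/(b^2-1) \leq b^2 - b + 1$ remains. The left side is at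
   most $b$ because $b \leq b^2 - 1$, and $b \leq b^2 - b + 1$ because $(b-1)^2 \geq 0$. *)
have -> : (1 - b^-1)^-1 / ((b - 1) * (b ^+ 2 - 1))
    = (b ^+ 2 / (b ^+ 2 - 1)) / (b * (b - 1) ^+ 2).
  by field; rewrite !gt_eqF //; lra.
rewrite /entry11_ratio ler_pM2r; last first.
  by rewrite invr_gt0 mulr_gt0 // exprn_gt0 //; lra.
by rewrite ler_pdivrMr; nra.
Qed.

(** The upper half of the squeeze, uniform in [n]: each entry is a constant times a partial Euler
    product, or falls under the bound for rows $j \geq 2$, up to symmetry. *)
Lemma max_inv_entry_le (R : realType) (b : R) (n : nat) :
  1 < b -> b + 1 <= b ^+ 2 ->
  max_inv_entry b n <= Num.max 1 (entry11_ratio b) * limn (euler_prod b).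
Proof.
move=> b1 bg; have U n' := euler_prod_le_lim _ b n' b1.
have U0 : 0 <= limn (euler_prod b) := le_trans (euler_prod_ge0 _ b 0 b1) (U 0).
set C := Num.max _ _.
have C1 : 1 <= C by rewrite le_max lexx.
have Cr : entry11_ratio b <= C by rewrite le_max lexx orbT.
(* This constant belongs to the entries $(0,1)$ and $(1,0)$; it never wins, since $b(b-1) \leq b^2 -
   b + 1$. *)
have inv_b1_le : (b - 1)^-1 <= C.
  apply: le_trans Cr; rewrite /entry11_ratio ler_pdivlMr; last first.
    by rewrite mulr_gt0 // ?exprn_gt0 //; lra.
  have -> : (b - 1)^-1 * (b * (b - 1) ^+ 2) = b * (b - 1).
    by field; rewrite gt_eqF; lra.
  lra.
have rU x n' : x <= C -> x * euler_prod b n' <= C * limn (euler_prod b).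
  move=> xC; apply: (le_trans (ler_wpM2r (euler_prod_ge0 _ b n' b1) xC)).
  by rewrite ler_wpM2l //; lra.
apply: mx_norm_le => [|j k]; first by rewrite mulr_ge0 //; lra.
have [j2|j2] := leqP 2 j.
  by rewrite (le_trans (norm_invmx_ge2_le _ _ _ _ _ b1 bg j2)) // ler_wpM2r.
have [k2|k2] := leqP 2 k.
  rewrite invmx_vandermonde_pow_sym.
  by rewrite (le_trans (norm_invmx_ge2_le _ _ _ _ _ b1 bg k2)) // ler_wpM2r.
(* Size 1 is treated apart, since the indices 0 and 1 are distinct only from size 2 on. *)
case: n j k j2 k2 => [[]|[|n]] // j k.
  move=> _ _; rewrite !ord1 norm_invmx_vandermonde_pow // coef0_prod_1subZX.
  by rewrite normr1 mul1r rU // big_geq.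
have E (i : 'I_n.+2) : (i < 2)%N -> i = 0 \/ i = 1.
  by case: i => [[|[|i]] Hi] // _; [left|right]; apply/val_inj.
move=> /E[]-> /E[]->.
- by rewrite norm_invmx_00 // -[leLHS]mul1r rU.
- by rewrite invmx_vandermonde_pow_sym norm_invmx_10 // rU.
- by rewrite norm_invmx_10 // rU.
- rewrite norm_invmx_11 // rU // (le_trans _ Cr) // gerBl.
  by rewrite !mulr_ge0 ?invr_ge0 ?exprn_ge0 //; lra.
Qed.

(** * Passage to the limit *)

Lemma cvg_max_inv_entry (R : realType) (b : R) :
  1 < b -> b + 1 <= b ^+ 2 ->
  max_inv_entry b n @[n --> \oo] -->
    Num.max 1 (entry11_ratio b) * limn (euler_prod b).
Proof.
move=> b1 bg; have cE : euler_prod b n @[n --> \oo] --> limn (euler_prod b).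
  exact: euler_prod_is_cvgn.
have squeeze (lo : nat -> R) :
    (forall n, lo n <= max_inv_entry b n.+2) ->
    lo n @[n --> \oo] --> Num.max 1 (entry11_ratio b) * limn (euler_prod b) ->
    max_inv_entry b n @[n --> \oo] -->
      Num.max 1 (entry11_ratio b) * limn (euler_prod b).
  move=> lo_le lo_cvg; rewrite -(cvg_shiftn 2).
  apply: (squeeze_cvgr _ lo_cvg (cvg_cst _)).
  by near=> n; rewrite /= addn2 lo_le max_inv_entry_le.
(* The lower bound is the entry with the larger limit: $(1,1)$ if the ratio is at least 1, else
   $(0,0)$. *)
have /orP[r1|r1] := le_total 1 (entry11_ratio b).
  apply: (squeeze (fun n => (entry11_ratio b - b ^- n.+2 * b / (b - 1) ^+ 2)
      * euler_prod b n)) => [n|].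
    by rewrite -norm_invmx_11 // entry_le_mx_norm.
  rewrite max_r //; apply: cvgM => //.
  rewrite -[X in _ --> X](subr0 (entry11_ratio b)).
  apply: cvgB; first exact: cvg_cst.
  rewrite -[X in _ --> X](mul0r (b / (b - 1) ^+ 2)).
  under eq_fun do rewrite -mulrA -exprVn -addn2.
  apply: cvgMl; rewrite (cvg_shiftn 2 (fun n => b^-1 ^+ n)).
  apply: cvg_expr; rewrite ger0_norm ?invr_ge0 ?invf_lt1 //; lra.
apply: (squeeze (fun n => euler_prod b n.+1)) => [n|].
  by rewrite -norm_invmx_00 // entry_le_mx_norm.
by rewrite max_l // mul1r (cvg_shiftS (euler_prod b)).
Unshelve. all: by end_near. Qed.

Theorem corollary9 (R : realType) (alpha : R)
    (halpha : root (alpha_poly R) alpha) (b : R) :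
  (alpha <= b ->
     max_inv_entry b n @[n --> \oo] -->
       inf_prod (fun t : nat => (1 - b ^- t)^-1))
  /\
  (golden_ratio R <= b <= alpha ->
     max_inv_entry b n @[n --> \oo] -->
       (b ^+ 2 - b + 1) / (b * (b - 1) ^+ 2) *
         inf_prod (fun t : nat => (1 - b ^- t)^-1)).
Proof.
have [x /andP[x23 _] /(_ alpha)[/(_ halpha) xE _]] := alpha_poly_root R.
have {x x23 xE} a23 : 23 / 10 < alpha by rewrite xE; lra.
have a0 : alpha ^+ 3 - 3 * alpha ^+ 2 + 2 * alpha - 1 = 0.
  by rewrite -(rootP halpha) /alpha_poly !hornerE.
(* The left side is the cubic evaluated at $b$; since [alpha] is a root, $b - \alpha$ divides it. *)
have factor : b * (b - 1) ^+ 2 - (b ^+ 2 - b + 1) = (b - alpha) *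
    (b ^+ 2 + alpha * b + alpha ^+ 2 - 3 * (b + alpha) + 2).
  by lra.
(* Four times the quotient is $(2b + \alpha - 3)^2 + 3\alpha^2 - 6\alpha - 1$, and the last three
   terms are positive already for $\alpha > 23/10$. *)
have quot0 : 0 < b ^+ 2 + alpha * b + alpha ^+ 2 - 3 * (b + alpha) + 2.
  by have := sqr_ge0 (2 * b + alpha - 3); nra.
split=> [ab|/andP[gb ba]].
- have den0 : 0 < b * (b - 1) ^+ 2 by rewrite mulr_gt0 ?exprn_gt0 //; lra.
  have r1 : entry11_ratio b <= 1.
    rewrite /entry11_ratio ler_pdivrMr // mul1r -subr_ge0 factor.
    by rewrite mulr_ge0 ?subr_ge0 // ltW.
  by have := cvg_max_inv_entry R b; rewrite (max_l r1) mul1r; apply; nra.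
- have s5 : Num.sqrt 5 ^+ 2 = 5 :> R by rewrite sqr_sqrtr.
  (* This gives $b \geq 3/2$; together with $s^2 = 5$, $b \geq (1+s)/2$ yields $b + 1 \leq b^2$. *)
  have s0 : 2 <= Num.sqrt 5 :> R.
    by rewrite -[leLHS]ger0_norm // -sqrtr_sqr ler_wsqrtr //; lra.
  move: gb; rewrite /golden_ratio; set s := Num.sqrt _ in s5 s0 * => gb.
  have den0 : 0 < b * (b - 1) ^+ 2 by rewrite mulr_gt0 ?exprn_gt0 //; lra.
  have r1 : 1 <= entry11_ratio b.
    rewrite /entry11_ratio ler_pdivlMr // mul1r -subr_le0 factor.
    by rewrite mulr_le0_ge0 ?subr_le0 // ltW.
  by have := cvg_max_inv_entry R b; rewrite (max_r r1); apply; nra.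
Qed.
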